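(* For every finite group $\mathfrak{G}$ there exist infinitely many pairwise non-isomorphic finite nut graphs $G$ such that $\mathrm{Aut}(G) \cong \mathfrak{G}$.
   Context: All graphs are finite, simple and connected. For a graph $G$, $\mathbf{A}(G)$ denotes its adjacency matrix and the nullity $\eta(G)$ is the dimension of the kernel of $\mathbf{A}(G)$. A nut graph is a simple graph of order at least 2 with $\eta(G)=1$ such that a (equivalently every) non-zero vector $\mathbf{x}=[x_1,\dots,x_n]^\intercal \in \ker \mathbf{A}(G)$ is full, i.e. $x_i \neq 0$ for all $i=1,\dots,n$. $\mathrm{Aut}(G)$ is the full automorphism group of $G$, i.e. the group of all permutations of $V(G)$ mapping edges to edges and non-edges to non-edges. *)

(* Defs.v *)
From HB Require Import structures.
From mathcomp Require Import all_boot all_order all_fingroup all_algebra.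

Set Implicit Arguments.
Unset Strict Implicit.
Unset Printing Implicit Defensive.

Import GroupScope GRing.Theory.
Local Open Scope ring_scope.

Record sgraph := SGraph {
  vertex :> finType;
  adj : rel vertex;
  adj_sym : symmetric adj;
  adj_irrefl : irreflexive adj
}.

Definition connected_graph (G : sgraph) : Prop :=
  forall x y : G, connect (@adj G) x y.

Definition graph_iso (G H : sgraph) : Prop :=
  exists f : G -> H, bijective f /\ forall x y : G, adj (f x) (f y) = adj x y.

Definition graph_aut (G : sgraph) : {set {perm G}} :=
  [set s : {perm G} | [forall x, forall y, adj (s x) (s y) == adj x y]].

Lemma graph_autP (G : sgraph) (s : {perm G}) :
  reflect (forall x y : G, adj (s x) (s y) = adj x y) (s \in graph_aut G).
Proof.
rewrite inE; apply: (iffP forallP) => [h x y|h x].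
  by have /forallP/(_ y)/eqP := h x.
by apply/forallP => y; rewrite h.
Qed.

Lemma graph_aut_group_set (G : sgraph) : group_set (graph_aut G).
Proof.
apply/group_setP; split; first by apply/graph_autP => x y; rewrite !perm1.
move=> s t /graph_autP hs /graph_autP ht; apply/graph_autP => x y.
by rewrite !permM ht hs.
Qed.

Canonical graph_aut_group (G : sgraph) : {group {perm G}} :=
  Group (graph_aut_group_set G).

Definition adj_mx (R : realFieldType) (G : sgraph) : 'M[R]_#|G| :=
  \matrix_(i, j) (adj (enum_val i) (enum_val j))%:R.

(* The column space of [cokermx A] is the kernel {x | A *m x = 0} of A acting
   on column vectors. *)
Definition nullity (R : realFieldType) (G : sgraph) : nat :=
  \rank (cokermx (adj_mx R G)).

Definition nut_graph (R : realFieldType) (G : sgraph) : Prop :=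
  [/\ (2 <= #|G|)%N,
      nullity R G = 1%N
    & forall x : 'cV[R]_#|G|,
        adj_mx R G *m x = 0 -> x != 0 -> forall i, x i 0 != 0].

(* Main.v *)
(** The graph is a spider with center [r] and two legs for every [g] in the
    group.  Leg 0 is the path r - l_0 - u_0, leg 1 is the path
    r - l_1 - u_1 - l_2 - u_2 - ... - l_2p - u_2p.  The nodes [u_k] carry
    further edges: u_j u_k for all distinct j, k >= 1 and u_0 u_k for odd k.
    These edges join nodes of the same group element, except that u_1 over [g]
    is joined to u_k over [v_k * g], where the voltages [v_k] run through the
    group.

    Nullity.  The equations at the links l_k express all node values in terms
    of the value at [r], and then the equations at the nodes determine the link
    values, from the end of each leg towards [r].  So the kernel has dimension
    at most 1.  The vector with value 1 at [r], -1 at u_0, (-1)^k at u_k, p at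
    l_0 and (-1)^k (p - floor((k - 1) / 2)) at l_k is in the kernel and full.

    Automorphisms.  The links have degree 2 and the nodes have degree at least
    3, so [r] is the only vertex all of whose neighbours have degree at most 2.
    Hence automorphisms fix [r], permute the legs preserving their lengths, and
    preserve the positions on them.  The edges at u_1 force the permutation of
    the group elements to commute with left multiplications, so it is a right
    multiplication. *)

Require Import Defs.
From HB Require Import structures.
From mathcomp Require Import all_boot all_order all_fingroup all_algebra.
From mathcomp Require Import zify ring.

Set Implicit Arguments.
Unset Strict Implicit.
Unset Printing Implicit Defensive.

Import GroupScope GRing.Theory Num.Theory.

(** * Kernel criterion for nut graphs *)

Section KernelCriterion.
Local Open Scope ring_scope.
Variables (R : realFieldType) (G : sgraph).

Definition nbr_sum (f : G -> R) (v : G) : R := \sum_w (adj v w)%:R * f w.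

Lemma adj_mx_mulE (x : 'cV[R]_#|G|) (v : G) :
  (adj_mx R G *m x) (enum_rank v) 0 = nbr_sum (fun w => x (enum_rank w) 0) v.
Proof.
rewrite mxE /nbr_sum (reindex (@enum_rank G)) /=; last first.
  by apply: onW_bij; apply: enum_rank_bij.
by apply: eq_bigr => w _; rewrite mxE !enum_rankK.
Qed.

Lemma nut_graph_of_kernel (f0 : G -> R) :
  (2 <= #|G|)%N -> (forall v, f0 v != 0) -> nbr_sum f0 =1 (fun=> 0) ->
  (forall f : G -> R, nbr_sum f =1 (fun=> 0) -> exists c, f =1 (fun v => c * f0 v)) ->
  nut_graph R G.
Proof.
move=> G2 f0n0 f0K f0U; pose x0 : 'cV[R]_#|G| := \col_i f0 (enum_val i).
have kerP (x : 'cV[R]_#|G|) : adj_mx R G *m x = 0 -> exists c, x = c *: x0.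
  move=> Ax0; have [v|c xE] := f0U (fun w => x (enum_rank w) 0).
    by rewrite -adj_mx_mulE Ax0 mxE.
  exists c; apply/colP => i; rewrite !mxE -[in LHS](enum_valK i).
  exact: xE.
have Ax0 : adj_mx R G *m x0 = 0.
  apply/colP => i; rewrite -(enum_valK i) adj_mx_mulE mxE -(f0K (enum_val i)).
  by apply: eq_bigr => w _; rewrite mxE enum_rankK.
have AT : (adj_mx R G)^T = adj_mx R G.
  by apply/matrixP => i j; rewrite !mxE adj_sym.
split=> //; last first.
  move=> x /kerP[c ->] cx0 i; rewrite !mxE mulf_neq0 //.
  by apply: contraNneq cx0 => ->; rewrite scale0r.
(* Cokernel and row kernel have equal rank; as the matrix is symmetric, the row kernel is spanned by
   the transpose of [x0]. *)
rewrite /nullity mxrank_coker -mxrank_ker.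
have /eqmxP -> : (kermx (adj_mx R G) == x0^T)%MS.
  apply/andP; split; last first.
    by apply/sub_kermxP; rewrite -AT -trmx_mul Ax0 trmx0.
  apply/row_subP => i; set u := row i _.
  have uK : u *m adj_mx R G = 0 by apply/sub_kermxP; rewrite row_sub.
  have [|c uE] := kerP u^T; first by rewrite -[adj_mx _ _]AT -trmx_mul uK trmx0.
  by rewrite -[u]trmxK uE linearZ scalemx_sub.
rewrite rank_rV; case: eqP => // /rowP x00.
have /card_gt0P[v _] : (0 < #|G|)%N by apply: leq_trans G2.
by have := x00 (enum_rank v); rewrite !mxE enum_rankK => /eqP; rewrite (negPf (f0n0 v)).
Qed.

End KernelCriterion.

(** * The spider graph and its connectedness *)

Section Construction.
Variables (gT : finGroupType) (p : nat).

Notation idx := 'I_(p.*2.+1).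

(* Index 0 is the only node of leg 0; indices 1, ..., 2p are the nodes of leg 1. *)
Definition node_adj (j k : nat) : bool :=
  if j == 0%N then odd k else if k == 0%N then odd j else j != k.

(* Adjacency of link [j] and node [k] over the same group element. *)
Definition leg_adj (j k : nat) : bool := (j == k) || ((j == k.+1) && (0 < k)%N).

(** Positions from 2 on enumerate the group; position 0 gets 1, so the edge between u_0 and u_1
    stays over one group element. *)
Definition voltage (k : nat) : gT := nth 1 [:: 1, 1 & enum gT] k.

(** An edge traversed backwards carries the inverse voltage, which makes adjacency symmetric. *)
Definition edge_voltage (j k : nat) : gT :=
  if j == 1%N then voltage k else if k == 1%N then (voltage j)^-1 else 1.

Definition spider_vertex : finType := (unit + gT * idx + gT * idx)%type.

Definition center : spider_vertex := inl (inl tt).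
Definition link (g : gT) (k : idx) : spider_vertex := inl (inr (g, k)).
Definition node (g : gT) (k : idx) : spider_vertex := inr (g, k).

Definition spider_adj (x y : spider_vertex) : bool :=
  match x, y with
  | inl (inl _), inl (inr (_, k)) | inl (inr (_, k)), inl (inl _) => (k <= 1)%N
  | inl (inr (g, j)), inr (h, k) | inr (h, k), inl (inr (g, j)) =>
      (g == h) && leg_adj j k
  | inr (g, j), inr (h, k) => node_adj j k && (h == edge_voltage j k * g)
  | _, _ => false
  end.

Lemma node_adjC : symmetric node_adj.
Proof. by move=> [|j] [|k] //; rewrite /node_adj /= eq_sym. Qed.

Lemma node_adjxx : irreflexive node_adj.
Proof. by case=> //= k; rewrite /node_adj /= eqxx. Qed.

Lemma edge_voltageV j k : node_adj j k -> edge_voltage k j = (edge_voltage j k)^-1.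
Proof.
rewrite /edge_voltage; case: eqP => [->|_]; case: eqP => [->|_];
  by rewrite ?node_adjxx ?invgK ?invg1.
Qed.

Lemma spider_adj_sym : symmetric spider_adj.
Proof.
move=> [[[]|[g j]]|[g j]] [[[]|[h k]]|[h k]] //=.
rewrite node_adjC; case kj: node_adj => //=.
by rewrite (edge_voltageV kj) eq_sym (canF_eq (mulKVg _)).
Qed.

Lemma spider_adj_irrefl : irreflexive spider_adj.
Proof. by move=> [[[]|[g j]]|[g j]] //=; rewrite node_adjxx. Qed.

Definition spider : sgraph := SGraph spider_adj_sym spider_adj_irrefl.

Lemma card_spider : #|spider| = (#|gT| * p.*2.+1).*2.+1.
Proof.
by rewrite !card_sum card_unit card_prod card_ord -[(_ * _).*2]addnn add1n addSn.
Qed.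

Lemma adj_center_link g (k : idx) : spider_adj center (link g k) = (k <= 1)%N.
Proof. by []. Qed.

Lemma adj_link_node g h (j k : idx) :
  spider_adj (link g j) (node h k) = (g == h) && leg_adj j k.
Proof. by []. Qed.

Lemma adj_node_node g h (j k : idx) :
  spider_adj (node g j) (node h k) = node_adj j k && (h == edge_voltage j k * g).
Proof. by []. Qed.

Lemma spider_connected : connected_graph spider.
Proof.
have csym : connect_sym spider_adj by apply/sym_connect_sym/spider_adj_sym.
have clink n : forall g (k : idx), (k <= n)%N -> connect spider_adj center (link g k).
  elim: n => [|n IHn] g k kn.
    by apply: connect1; rewrite adj_center_link; lia.
  case: (leqP k 1) => k1; first by apply: connect1; rewrite adj_center_link.
  have kb : (k.-1 < p.*2.+1)%N by have := ltn_ord k; lia.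
  have ck : connect spider_adj center (link g (Ordinal kb)) by apply: IHn => /=; lia.
  apply: connect_trans ck _.
  have c1 : connect spider_adj (link g (Ordinal kb)) (node g (Ordinal kb)).
    by apply: connect1; rewrite adj_link_node /leg_adj !eqxx.
  apply: connect_trans c1 _; rewrite csym; apply: connect1.
  by rewrite adj_link_node eqxx /leg_adj /=; lia.
have cc x : connect spider_adj center x.
  case: x => [[[]|[g k]]|[g k]]; first exact: connect0.
    exact: clink (leqnn _).
  apply: (connect_trans (clink _ g k (leqnn _))); apply: connect1.
  by rewrite adj_link_node /leg_adj !eqxx.
by move=> x y; apply: connect_trans (cc y); rewrite csym.
Qed.

End Construction.

(** * The null space of the spider *)

Section Nullspace.
Local Open Scope ring_scope.
Variables (R : realFieldType) (gT : finGroupType) (p : nat).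
Notation idx := 'I_(p.*2.+1).
Notation V := (spider gT p).
Implicit Types (f : V -> R) (g : gT) (j k : idx).

Lemma sum_spider (F : V -> R) :
  \sum_v F v = F (center gT p) + \sum_g \sum_(k < p.*2.+1) F (link g k)
               + \sum_g \sum_(k < p.*2.+1) F (node g k).
Proof.
rewrite !big_sumType (big_pred1 tt) /=; last by case.
by rewrite !pair_bigA; congr (_ + _ + _); apply: eq_bigr => -[].
Qed.

Lemma sum_eqb (T : finType) (a : T) (F : T -> R) : \sum_x (x == a)%:R * F x = F a.
Proof.
rewrite (bigD1 a) //= eqxx mul1r big1 ?addr0 // => x /negPf ->.
by rewrite mul0r.
Qed.

Lemma sum_ord_eqb n (a : nat) (F : 'I_n.+1 -> R) :
  \sum_(k < n.+1) (k == a :> nat)%:R * F k = if (a <= n)%N then F (inord a) else 0.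
Proof.
case: leqP => an; last first.
  by apply: big1 => k _; rewrite (_ : _ == _ = false) ?mul0r //; have := ltn_ord k; lia.
rewrite -[RHS](sum_eqb (inord a) F); apply: eq_bigr => k _.
by rewrite -val_eqE /= inordK.
Qed.

Lemma nbr_sum_center f :
  nbr_sum f (center gT p) = \sum_g \sum_(k < p.*2.+1) (k <= 1)%:R * f (link g k).
Proof.
rewrite /nbr_sum sum_spider /= mul0r add0r [X in _ + X]big1 ?addr0 // => g _.
by rewrite big1 // => k _; rewrite mul0r.
Qed.

Lemma nbr_sum_link f g j :
  nbr_sum f (link g j) = (j <= 1)%:R * f (center gT p)
    + \sum_(k < p.*2.+1) (leg_adj j k)%:R * f (node g k).
Proof.
rewrite /nbr_sum sum_spider /= [X in _ + X + _]big1 ?addr0; last first.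
  by move=> h _; rewrite big1 // => k _; rewrite mul0r.
congr (_ + _); rewrite exchange_big /=; apply: eq_bigr => k _.
rewrite -(sum_eqb g (fun h => (leg_adj j k)%:R * f (node h k))).
by apply: eq_bigr => h _; rewrite mulrA -natrM mulnb eq_sym.
Qed.

Lemma nbr_sum_node f g k :
  nbr_sum f (node g k) = \sum_(j < p.*2.+1) (leg_adj j k)%:R * f (link g j)
    + \sum_(j < p.*2.+1) (node_adj k j)%:R * f (node (edge_voltage gT k j * g)%g j).
Proof.
rewrite /nbr_sum sum_spider /= mul0r add0r; congr (_ + _).
  rewrite exchange_big /=; apply: eq_bigr => j _.
  rewrite -(sum_eqb g (fun h => (leg_adj j k)%:R * f (link h j))).
  by apply: eq_bigr => h _; rewrite mulrA -natrM mulnb.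
rewrite exchange_big /=; apply: eq_bigr => j _.
rewrite -(sum_eqb (edge_voltage gT k j * g)%g (fun h => (node_adj k j)%:R * f (node h j))).
by apply: eq_bigr => h _; rewrite mulrA -natrM mulnb andbC.
Qed.

Lemma sum_leg_nodes (F : idx -> R) j :
  \sum_(k < p.*2.+1) (leg_adj j k)%:R * F k
  = F j + (if (1 < j)%N then F (inord j.-1) else 0).
Proof.
rewrite (eq_bigr (fun k : idx => (k == j)%:R * F k
   + (1 < j)%:R * ((k == j.-1 :> nat)%:R * F k))); last first.
  move=> k _; rewrite mulrA -natrM -mulrDl -natrD; congr (_%:R * _).
  by rewrite -val_eqE /leg_adj /=; lia.
rewrite big_split /= sum_eqb -mulr_sumr sum_ord_eqb.
case: (ltnP 1 j) => j1; rewrite ?mul0r // mul1r.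
by rewrite (_ : (j.-1 <= p.*2)%N) //; have := ltn_ord j; lia.
Qed.

Lemma sum_leg_links (F : idx -> R) k :
  \sum_(j < p.*2.+1) (leg_adj j k)%:R * F j
  = F k + (if (0 < k < p.*2)%N then F (inord k.+1) else 0).
Proof.
rewrite (eq_bigr (fun j : idx => (j == k)%:R * F j
   + (0 < k)%:R * ((j == k.+1 :> nat)%:R * F j))); last first.
  move=> j _; rewrite mulrA -natrM -mulrDl -natrD; congr (_%:R * _).
  by rewrite -val_eqE /leg_adj /=; lia.
rewrite big_split /= sum_eqb -mulr_sumr sum_ord_eqb.
by case: (0 < k)%N; rewrite ?mul0r ?mul1r.
Qed.

Lemma kernel_center0 f :
  nbr_sum f =1 (fun=> 0) -> f (center gT p) = 0 -> f =1 (fun=> 0).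
Proof.
move=> fK fc.
have fnode n : forall g k, (k <= n)%N -> f (node g k) = 0.
  elim: n => [|n IHn] g k kn; have := fK (link g k);
    rewrite nbr_sum_link fc mulr0 add0r sum_leg_nodes; case: ltnP => k1.
  - lia.
  - by rewrite addr0.
  - by rewrite [f (node _ (inord _))]IHn ?addr0 // inordK //; have := ltn_ord k; lia.
  - by rewrite addr0.
have fnd g k : f (node g k) = 0 by apply: fnode (leqnn _).
(* With all nodes zero, the equation at a node involves only its own link and the next one; [n]
   bounds the distance to position 2p. *)
have flink n : forall g k, (p.*2 <= n + k)%N -> f (link g k) = 0.
  elim: n => [|n IHn] g k kn; have := fK (node g k);
    rewrite nbr_sum_node [X in _ + X]big1 ?addr0; try by move=> j _; rewrite fnd mulr0.
  - by rewrite sum_leg_links; case: ifP => [|_]; [lia|rewrite addr0].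
  - rewrite sum_leg_links; case: ifP => [kk|_]; last by rewrite addr0.
    by rewrite [f (link _ (inord _))]IHn ?addr0 // inordK //; lia.
move=> [[[]|[g k]]|[g k]] //; last exact: fnd.
by apply: (flink p.*2); lia.
Qed.

(** Both u_0 and u_1 come first on their legs and must cancel the value 1 at the center, hence the
    exception at 0. *)
Definition node_val (k : nat) : R := if k == 0%N then -1 else (-1) ^+ k.

(** The natural subtraction is positive up to k = 2p, which gives fullness, and reaches 0 at k = 2p
    + 1. *)
Definition link_val (k : nat) : R :=
  if k == 0%N then p%:R else (-1) ^+ k * (p - k.-1./2)%:R.

Definition spider_null : V -> R := fun v =>
  match v with
  | inl (inl _) => 1
  | inl (inr (_, k)) => link_val k
  | inr (_, k) => node_val k
  end.

Lemma spider_null_neq0 v : (0 < p)%N -> spider_null v != 0.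
Proof.
move=> p0; case: v => [[[]|[g k]]|[g k]] /=; first by rewrite oner_eq0.
- have := ltn_ord k; rewrite /link_val; case: ifP => k0 kp.
    by rewrite pnatr_eq0 -lt0n.
  by rewrite mulf_neq0 ?signr_eq0 // pnatr_eq0; lia.
- by rewrite /node_val; case: ifP => _; rewrite ?signr_eq0 // oppr_eq0 oner_eq0.
Qed.

Lemma sum_alternating n : \sum_(j < n.*2) (-1) ^+ j.+1 = 0 :> R.
Proof.
elim: n => [|n IHn]; first by rewrite big_ord0.
by rewrite doubleS !big_ord_recr /= IHn [X in _ + X]exprS; ring.
Qed.

Lemma sum_odd_alternating n : \sum_(j < n.*2.+1) (odd j)%:R * node_val j = - n%:R.
Proof.
elim: n => [|n IHn]; first by rewrite big_ord_recr big_ord0 /= mul0r addr0 oppr0.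
rewrite doubleS 2!big_ord_recr /= IHn /= !odd_double /= mul0r addr0 mul1r /node_val /=.
by rewrite -signr_odd /= odd_double /= expr1 -natr1; ring.
Qed.

(** The values at u_1, ..., u_2p sum to 0, so omitting u_k leaves -(-1)^k; u_0 adds -1 when k is
    odd. *)
Lemma sum_node_val k :
  (0 < k)%N -> \sum_(j < p.*2.+1) (node_adj k j)%:R * node_val j = - (odd k)%:R - (-1) ^+ k.
Proof.
move=> k0; rewrite big_ord_recl /= {1}/node_adj gtn_eqF //= {1}/node_val /= mulrN1.
congr (_ + _); have kb : (k.-1 < p.*2)%N by have := ltn_ord k; lia.
have := sum_alternating p; rewrite (bigD1 (Ordinal kb)) //= prednK // => /eqP.
rewrite addrC addr_eq0 => /eqP <-; rewrite [RHS]big_mkcond /=; apply: eq_bigr => j _.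
rewrite /node_adj gtn_eqF //= /bump /= add1n /node_val /= -val_eqE /=.
by rewrite (_ : (j != k.-1 :> nat) = (k != j.+1 :> nat)) ?mulr_natl ?mulrb //; lia.
Qed.

Lemma link_val_step (k : nat) : (0 < k <= p.*2)%N ->
  link_val k + link_val k.+1 = (odd k)%:R + (-1) ^+ k.
Proof.
case: k => [|k] //= kp; rewrite /link_val /= !exprS.
(* [k] is now the old index minus one; the floor grows in the next step exactly when its parity [b]
   is 1. *)
have [i [b kE]] : exists i (b : bool), k = (b + i.*2)%N.
  by exists k./2, (odd k); rewrite odd_double_half.
rewrite {k}kE in kp *.
have -> : ((b + i.*2)./2 = i)%N by case: (b); lia.
have -> : (uphalf (b + i.*2) = i + b)%N by case: (b); lia.
have -> : (-1) ^+ (b + i.*2) = (-1) ^+ b :> R by rewrite exprD -mul2n exprM sqrrN !expr1n mulr1.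
rewrite oddD odd_double addbF oddb; case: b kp => /= kp; rewrite ?expr1 ?expr0.
  have -> : (p - i = (p - (i + 1)).+1)%N by lia.
  by rewrite -natr1; ring.
by rewrite addn0; ring.
Qed.

(** The vector depends only on the position, so the voltages drop out of the equations. *)
Lemma spider_null_kernel : (0 < p)%N -> nbr_sum spider_null =1 (fun=> 0).
Proof.
move=> p0 [[[]|[g k]]|[g k]].
- rewrite nbr_sum_center; apply: big1 => g _.
  rewrite (eq_bigr (fun k : idx => (k == 0 :> nat)%:R * link_val k
     + (k == 1 :> nat)%:R * link_val k)); last first.
    by move=> k _ /=; rewrite -mulrDl -natrD; congr (_%:R * _); lia.
  rewrite big_split /= !sum_ord_eqb /= double_gt0 p0 !inordK // ?ltnS ?double_gt0 //.
  by rewrite /link_val /= expr1 subn0; ring.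
- rewrite nbr_sum_link sum_leg_nodes /= mulr1 /node_val.
  case: k => [[|[|k]] kp] /=; first by rewrite addr0 subrr.
    by rewrite addr0 expr1 subrr.
  by rewrite inordK /= ?exprS; [ring|lia].
rewrite nbr_sum_node sum_leg_links /=; case: (posnP k) => [k0|kp].
  by rewrite k0 /= (sum_odd_alternating p) /link_val /= addr0 subrr.
rewrite sum_node_val // -opprD -[X in _ - X](@link_val_step k); last by have := ltn_ord k; lia.
case: ltnP => kp2 /=; first by rewrite inordK // subrr.
(* Here k = 2p: there is no next link, and [link_val] vanishes at 2p + 1. *)
rewrite addr0 opprD addrA subrr sub0r /link_val /=.
by rewrite (_ : (p - k./2 = 0)%N) ?mulr0 ?oppr0 //; lia.
Qed.

Lemma spider_nut : (0 < p)%N -> nut_graph R V.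
Proof.
move=> p0; apply: (@nut_graph_of_kernel _ _ spider_null).
- rewrite card_spider ltnS double_gt0 muln_gt0 andbT.
  by apply/card_gt0P; exists 1%g.
- by move=> v; apply: spider_null_neq0.
- exact: spider_null_kernel.
(* The null vector is 1 at the center, so subtracting this multiple gives a kernel vector vanishing
   there. *)
move=> f fK; exists (f (center gT p)) => v; apply/eqP; rewrite -subr_eq0; apply/eqP.
move: v; apply: kernel_center0; last by rewrite /= mulr1 subrr.
move=> v; rewrite -[RHS](subrr 0) -{1}(fK v) -(mulr0 (f (center gT p))).
rewrite -(spider_null_kernel p0 v) /nbr_sum mulr_sumr -sumrB.
by apply: eq_bigr => w _; ring.
Qed.

End Nullspace.

(** * Degree at least 3 as an automorphism invariant *)

Section Branching.
Variable G : sgraph.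
Implicit Types (x y : G) (s : {perm G}).

Definition branching x : Prop :=
  exists a b c : G, [/\ adj x a, adj x b & adj x c] /\ [/\ a != b, b != c & a != c].

Lemma graph_aut_branching s x : s \in graph_aut G -> branching (s x) <-> branching x.
Proof.
have fwd t y : t \in graph_aut G -> branching y -> branching (t y).
  move=> /graph_autP tA [a [b [c [[xa xb xc] [ab bc ac]]]]].
  by exists (t a), (t b), (t c); rewrite !tA !(inj_eq perm_inj).
move=> sA; split; last exact: fwd.
by move=> /(fwd s^-1); rewrite permK groupV; apply.
Qed.

End Branching.

(** * Automorphisms of the spider *)

Section Rigidity.
Variables (gT : finGroupType) (p : nat).
Hypothesis p_gt1 : (1 < p)%N.
Notation idx := 'I_(p.*2.+1).
Notation V := (spider gT p).
Implicit Types (g h : gT) (j k : idx) (s : {perm V}).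

Lemma spider_idx n : (n <= 3)%N -> (n < p.*2.+1)%N. Proof. lia. Qed.

Let i1 : idx := Ordinal (spider_idx (isT : 1 <= 3)%N).
Let i2 : idx := Ordinal (spider_idx (isT : 2 <= 3)%N).
Let i3 : idx := Ordinal (spider_idx (isT : 3 <= 3)%N).

(** Besides its own link, a node has neighbours at two distinct positions among 1, 2, 3. *)
Lemma node_branching g k : @branching V (node g k).
Proof.
have br (a b : idx) : node_adj k a -> node_adj k b -> (a != b) -> @branching V (node g k).
  move=> ka kb ab.
  exists (link g k), (node (edge_voltage gT k a * g) a), (node (edge_voltage gT k b * g) b).
  rewrite /= !eqxx ka kb /leg_adj eqxx; split=> //; split=> //.
  by apply: contraNneq ab => -[_ ->].
have [k0|k0] := eqVneq (k : nat) 0%N; first by apply: (br i1 i3); rewrite // k0.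
have [k1|k1] := eqVneq (k : nat) 1%N; first by apply: (br i2 i3); rewrite // k1.
have [k2|k2] := eqVneq (k : nat) 2%N; first by apply: (br i1 i3); rewrite // k2.
by apply: (br i1 i2); rewrite // /node_adj (negPf k0).
Qed.

Lemma link_nbrP g k (v : V) : adj (link g k : V) v ->
  [\/ v = center gT p /\ (k <= 1)%N, v = node g k
    | exists2 j : idx, k = j.+1 :> nat /\ (0 < j)%N & v = node g j].
Proof.
case: v => [[[]|[h j]]|[h j]] //=; first by move=> k1; constructor 1.
case/andP=> /eqP <- /orP[/eqP kj|/andP[/eqP kj j0]].
  by constructor 2; congr node; apply: val_inj.
by constructor 3; exists j.
Qed.

(** Besides its own node, a link sees the center if k <= 1 and the preceding node if k > 1, never
    both. *)
Lemma link_not_branching g k : ~ @branching V (link g k).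
Proof.
move=> [a [b [c [[ka kb kc] [ab bc ac]]]]]; move: ab bc ac.
have same j j' : k = j.+1 :> nat -> k = j'.+1 :> nat -> j = j'.
  by move=> -> [jj]; apply: val_inj.
case/link_nbrP: ka => [[-> k1]|->|[j [kj j0] ->]];
case/link_nbrP: kb => [[-> k2]|->|[j' [kj' j0'] ->]]; rewrite ?eqxx //;
case/link_nbrP: kc => [[-> k3]|->|[j'' [kj'' j0''] ->]]; rewrite ?eqxx //; try lia;
by rewrite ?(same _ _ kj' kj) ?(same _ _ kj'' kj) ?(same _ _ kj'' kj') ?eqxx.
Qed.

Lemma node_link_nbrP g k (v : V) : adj (node g k : V) v ->
  [\/ v = link g k, exists2 j : idx, j = k.+1 :> nat /\ (0 < k)%N & v = link g j
    | exists h (j : idx), v = node h j].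
Proof.
case: v => [[[]|[h j]]|[h j]] //=; last by constructor 3; exists h, j.
case/andP=> /eqP -> /orP[/eqP kj|/andP[/eqP kj j0]].
  by constructor 1; congr link; apply: val_inj.
by constructor 2; exists j.
Qed.

Lemma center_unique (v : V) :
  (forall w : V, adj v w -> ~ branching w) <-> v = center gT p.
Proof.
split=> [|->]; last by move=> [[[]|[h j]]|[h j]] //= _; apply: link_not_branching.
case: v => [[[]|[g k]]|[g k]] // nb.
  by case: (nb (node g k)); [rewrite /= /leg_adj !eqxx|apply: node_branching].
have [j kj] : exists j : idx, node_adj k j.
  have [k0|k0] := eqVneq (k : nat) 0%N; first by exists i1; rewrite k0.
  have [k1|k1] := eqVneq (k : nat) 1%N; first by exists i2; rewrite k1.
  by exists i1; rewrite /node_adj (negPf k0).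
case: (nb (node (edge_voltage gT k j * g) j)); last exact: node_branching.
by rewrite /= kj eqxx.
Qed.

Lemma aut_center s : s \in graph_aut V -> s (center gT p) = center gT p.
Proof.
move=> sA; apply/center_unique => w cw.
rewrite -(permKV s w) in cw *; rewrite (graph_aut_branching _ sA).
by apply: (center_unique (center gT p)).2 => //; move/graph_autP: sA cw => ->.
Qed.

Lemma aut_center_inv s (v : V) :
  s \in graph_aut V -> s v = center gT p -> v = center gT p.
Proof. by move=> sA sv; apply: (@perm_inj _ s); rewrite sv aut_center. Qed.

Lemma aut_node s g k : s \in graph_aut V -> exists h j, s (node g k) = node h j.
Proof.
move=> sA; have := (@graph_aut_branching V s (node g k) sA).2 (node_branching g k).
case E: (s (node g k)) => [[[]|[h j]]|[h j]]; last by exists h, j.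
- by have := aut_center_inv sA E.
- by move/link_not_branching.
Qed.

Lemma aut_link s g k : s \in graph_aut V -> exists h j, s (link g k) = link h j.
Proof.
move=> sA; case E: (s (link g k)) => [[[]|[h j]]|[h j]].
- by have := aut_center_inv sA E.
- by exists h, j.
- have [h' [j' E']] := aut_node h j (groupVr sA).
  have hjE : node h j = s (link g k) by rewrite E.
  by move: E'; rewrite hjE permK.
Qed.

(* Leg 0 ends at its first node, leg 1 does not. *)
Lemma aut_link0 s g : s \in graph_aut V -> exists h, s (link g ord0) = link h ord0.
Proof.
move=> sA; have [h [j E]] := aut_link g ord0 sA; have /graph_autP sadj := sA.
have : adj (center gT p : V) (link h j) by rewrite -E -(aut_center sA) sadj.
rewrite /= => j1; have [j0|j0] := eqVneq (j : nat) 0%N.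
  by exists h; rewrite E; congr link; apply: val_inj.
have {j1 j0} ji : j = i1 by apply: val_inj => /=; lia.
(* The node after this link would map to u_1, which has a further link l_2; its preimage would be a
   second link at u_0. *)
rewrite {j}ji in E; exfalso.
have [h' [j E']] := aut_node g ord0 sA.
have : adj (link h i1 : V) (node h' j) by rewrite -E -E' sadj /= eqxx.
case/link_nbrP => [[] //|[hh jj]|[j' [/= j'1 j'0] _]]; last by lia.
rewrite {h'}hh {j}jj in E'.
have : adj (s (node g ord0)) (link h i2) by rewrite E' /= eqxx.
have [h2 [j2 E2]] := aut_link h i2 (groupVr sA).
rewrite -(permKV s (link h i2)) sadj E2 => /node_link_nbrP[F|[j' [_ //] _]|[h3 [j3 //]]].
by move: (E); rewrite -F -E2 permKV.
Qed.

(** Otherwise the inverse automorphism would move a link at position 0 to position 1. *)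
Lemma aut_link1 s g : s \in graph_aut V -> exists h, s (link g i1) = link h i1.
Proof.
move=> sA; have [h [j E]] := aut_link g i1 sA; have /graph_autP sadj := sA.
have : adj (center gT p : V) (link h j) by rewrite -E -(aut_center sA) sadj.
rewrite /= => j1; have [j0|j0] := eqVneq (j : nat) 0%N; last first.
  by exists h; rewrite E; congr link; apply: val_inj => /=; lia.
have jj : j = ord0 by apply: val_inj.
by have [h' ] := aut_link0 h (groupVr sA); rewrite -{1}jj -E permK.
Qed.

(** Walking outwards, each next vertex has only one possible image, since the other candidate is
    already the image of its predecessor of the same kind. *)
Lemma aut_leg s g h n : s \in graph_aut V -> s (link g i1) = link h i1 ->
  forall k, (0 < k <= n)%N -> s (link g k) = link h k /\ s (node g k) = node h k.
Proof.
move=> sA sgh; have /graph_autP sadj := sA.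
elim: n => [|n IHn] k kn; first by lia.
have [kn'|kn'] := leqP k n; first by apply: IHn; lia.
have kE : k = n.+1 :> nat by lia.
have [k1|k1] := leqP k 1.
  have -> : k = i1 by apply: val_inj => /=; lia.
  split=> //; have [h' [j E]] := aut_node g i1 sA.
  have : adj (s (link g i1)) (s (node g i1)) by rewrite sadj /= eqxx.
  by rewrite sgh E => /link_nbrP[[] //|//|[j' [/= j'1 j'0] _]]; lia.
have nb : (n < p.*2.+1)%N by have := ltn_ord k; lia.
pose k' : idx := Ordinal nb.
have [sl' sn'] : s (link g k') = link h k' /\ s (node g k') = node h k'.
  by apply: IHn => /=; lia.
have sl : s (link g k) = link h k.
  have [h1 [j E]] := aut_link g k sA.
  have : adj (s (node g k')) (s (link g k)) by rewrite sadj /= eqxx /leg_adj /=; lia.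
  rewrite sn' E => /node_link_nbrP[F|[j' [/= jE _] ->]|[h3 [j3 //]]].
    by move: E; rewrite F -sl' => /perm_inj [kk]; move: kE; rewrite kk /=; lia.
  by congr link; apply: val_inj; rewrite /= jE kE.
split=> //; have [h1 [j E]] := aut_node g k sA.
have : adj (s (link g k)) (s (node g k)) by rewrite sadj /= !eqxx /leg_adj eqxx.
rewrite sl E => /link_nbrP[[] //|//|[j' [kj j0] F]].
have jk : j' = k' by apply: val_inj => /=; lia.
by move: E; rewrite F jk -sn' => /perm_inj [kk]; move: kE; rewrite kk /=; lia.
Qed.

Definition translate_fun (a : gT) (v : spider_vertex gT p) : spider_vertex gT p :=
  match v with
  | inl (inl _) => center gT p
  | inl (inr (g, k)) => link (g * a) k
  | inr (g, k) => node (g * a) k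
  end.

Lemma translate_fun_inj a : injective (translate_fun a).
Proof.
by move=> [[[]|[g j]]|[g j]] [[[]|[h k]]|[h k]] //= [] /mulIg -> ->.
Qed.

Definition translate (a : gT) : {perm V} := perm (@translate_fun_inj a).

(** Voltages multiply on the left, hence commute with right translations. *)
Lemma translate_aut a : translate a \in graph_aut V.
Proof.
apply/graph_autP => x y; rewrite !permE.
case: x y => [[[]|[g j]]|[g j]] [[[]|[h k]]|[h k]] //=; rewrite ?(inj_eq (mulIg a)) //.
by rewrite mulgA (inj_eq (mulIg a)).
Qed.

(** The last enumerated element sits at position #|gT| + 1, which is at most 2p. *)
Lemma voltage_surj (g : gT) : (#|gT| < p.*2)%N -> exists2 k : idx, (1 < k)%N & voltage gT k = g.
Proof.
move=> np; have ib : (index g (enum gT) < #|gT|)%N by rewrite cardE index_mem mem_enum.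
have kb : ((index g (enum gT)).+2 < p.*2.+1)%N by lia.
by exists (Ordinal kb) => //; rewrite /voltage /= nth_index ?mem_enum.
Qed.

Lemma graph_aut_translate s :
  (#|gT| < p.*2)%N -> s \in graph_aut V -> exists a, s = translate a.
Proof.
move=> np sA; have /graph_autP sadj := sA.
(* The action on group elements, read off from the first links of legs 1; [aut_link1] excludes the
   default. *)
pose sg g := if s (link g i1) is inl (inr (h, _)) then h else 1.
have sg1 g : s (link g i1) = link (sg g) i1.
  by rewrite /sg; have [h ->] := aut_link1 g sA.
have legs g k : (0 < k)%N -> s (link g k) = link (sg g) k /\ s (node g k) = node (sg g) k.
  by move=> k0; apply: (aut_leg sA (sg1 g) (n := k)); rewrite k0 /=.
(* Leg 0 follows leg 1 over the same element because the edge between u_0 and u_1 has voltage 1. *)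
have leg0 g : s (link g ord0) = link (sg g) ord0 /\ s (node g ord0) = node (sg g) ord0.
  have [h E] := aut_link0 g sA.
  have [h' [j E']] := aut_node g ord0 sA.
  have : adj (s (link g ord0)) (s (node g ord0)) by rewrite sadj /= eqxx.
  rewrite E E' => /link_nbrP[[] //|F|[j' [] //] _].
  have : adj (s (node g ord0)) (s (node g i1)) by rewrite sadj /= /edge_voltage /= invg1 mul1g eqxx.
  rewrite E' F (legs g i1 isT).2 /= /edge_voltage /= invg1 mul1g => /eqP ->.
  by [].
(* Choose a position with voltage [c] and transport its edge to u_1 over [g]. *)
have sgM c g : sg (c * g) = c * sg g.
  have [k k1 <-] := voltage_surj c np.
  have : adj (s (node g i1)) (s (node (voltage gT k * g) k)).
    by rewrite sadj /= /edge_voltage /= eqxx /node_adj /= andbT; case: eqP; lia.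
  by rewrite (legs g i1 isT).2 (legs _ k _).2 ?(ltnW k1) //= => /andP[_ /eqP].
exists (sg 1); apply/permP => v; rewrite permE.
have sgE g : sg g = g * sg 1 by rewrite -sgM mulg1.
case: v => [[[]|[g k]]|[g k]] /=; rewrite -?sgE; first exact: aut_center.
  have [k0|k0] := eqVneq (k : nat) 0%N; last by apply: (legs g k _).1; lia.
  by rewrite (_ : k = ord0) ?(leg0 g).1 //; apply: val_inj.
have [k0|k0] := eqVneq (k : nat) 0%N; last by apply: (legs g k _).2; lia.
by rewrite (_ : k = ord0) ?(leg0 g).2 //; apply: val_inj.
Qed.

(** Products of permutations apply the left factor first, matching right multiplication. *)
Lemma translateM : {in [set: gT] &, {morph translate : a b / a * b}}.
Proof.
move=> a b _ _; apply/permP => v; rewrite permM !permE.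
by case: v => [[[]|[g k]]|[g k]] //=; rewrite mulgA.
Qed.

Canonical translate_morphism := Morphism translateM.

Lemma spider_aut : (#|gT| < p.*2)%N -> [set: gT] \isog graph_aut V.
Proof.
move=> np; have inj : 'injm translate_morphism.
  apply/injmP => a b _ _ /permP/(_ (node 1 ord0)).
  by rewrite !permE /= !mul1g => -[].
have := sub_isog (subxx _) inj; congr (_ \isog _).
apply/setP => s; apply/morphimP/idP => [[a _ _ ->]|sA]; first exact: translate_aut.
by have [a ->] := graph_aut_translate np sA; exists a; rewrite ?inE.
Qed.

End Rigidity.

(** * Infinitely many spiders for each group *)

Theorem theorem1 (R : realFieldType) (gT : finGroupType) (K : {group gT}) :
  exists F : nat -> sgraph,
    (forall i : nat,
        [/\ connected_graph (F i),
            nut_graph R (F i)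
          & isog (graph_aut (F i)) K]) /\
    (forall i j : nat, i <> j -> ~ graph_iso (F i) (F j)).
Proof.
pose S : finGroupType := subg_of K.
have n0 : (0 < #|S|)%N by apply/card_gt0P; exists 1.
(* This choice of p is at least 2 and satisfies #|S| < 2p for every [i]. *)
exists (fun i => spider S (#|S| + i.+1)); split=> [i|i j ij].
  split; first exact: spider_connected.
    by apply: spider_nut; rewrite addnS.
  rewrite isog_sym; apply: isog_trans (isog_subg K) _.
  apply: spider_aut; first by rewrite addnS ltnS addn_gt0 n0.
  by rewrite -addnn; apply: leq_trans (leq_addr _ _); rewrite addnS ltnS leq_addr.
(* The order of the spider determines p, hence the index. *)
case=> f [/bij_eq_card]; rewrite !card_spider => -[/double_inj/eqP].
by rewrite eqn_pmul2l // => /eqP[/double_inj/addnI[]].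
Qed.
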